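(* Let $\tilde p<0$ be an integer and $\tilde q$ a positive integer with $\tilde q\geqslant 97|\tilde p|$. Put $A=\tilde q^{2}+5\tilde p\tilde q+10\tilde p^{2}$, let $p=\tilde p+\tilde q$ and $q=\tilde q$. Then there is no integer $t$ with $A<t<A+\dfrac{74|\tilde p|^3}{\tilde q}$ producing a perfect cuboid, i.e. no such integer $t$ satisfies all of the inequalities $$t>p^2,\qquad t>pq,\qquad t>q^2,\qquad (p^2+t)(pq+t)>2t^2.$$
   Context: A perfect cuboid is a rectangular parallelepiped whose edges, face diagonals and space diagonal all have integer lengths. By a previously established criterion, a triple of positive integers $p,q,t$ with $p\neq q$ coprime satisfying $Q_{pq}(t)=0$, where $Q_{pq}(t)=t^{10}+(2q^2+p^2)(3q^2-2p^2)t^8+(q^8+10p^2q^6+4p^4q^4-14p^6q^2+p^8)t^6-p^2q^2(q^8-14p^2q^6+4p^4q^4+10p^6q^2+p^8)t^4-p^6q^6(q^2+2p^2)(3p^2-2q^2)t^2-q^{10}p^{10}$, produces a perfect cuboid if and only if $t>p^2$, $t>pq$, $t>q^2$ and $(p^2+t)(pq+t)>2t^2$. *)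

(* Defs.v *)
From mathcomp Require Export all_boot all_order all_algebra.
Export Order.TTheory GRing.Theory Num.Theory.

Open Scope ring_scope.

(* Criterion under which a positive integer root t of the tenth-degree cuboid
   polynomial with coprime positive parameters p <> q yields a perfect cuboid. *)
Definition cuboid_inequalities (p q t : int) : Prop :=
  [/\ t > p ^+ 2, t > p * q, t > q ^+ 2
    & (p ^+ 2 + t) * (p * q + t) > 2 * t ^+ 2].

(* Main.v *)
Require Import Defs.
From mathcomp Require Import all_boot all_order all_algebra.
From mathcomp Require Import ring lra.
Local Open Scope ring_scope.

(** Writing [p < 0] and [q] for the parameters, the upper end of the interval is
    [q ^+ 2 + 5 p q + 10 p ^+ 2 + 74 |p| ^+ 3 / q]. If [k |p| <= q], the last term
    is at most [(74 / k) p ^+ 2] while [5 p q <= - 5 k p ^+ 2]. For [k = 97] the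
    negative term outweighs the other two, so the interval lies below [q ^+ 2] and
    the inequality [t > q ^+ 2] already fails. *)

Section IntervalEnd.
Variable F : realFieldType.
Implicit Types a b c d k p q : F.

Lemma ler_exprS_div k a q n : 0 < k -> 0 < q -> 0 <= a -> k * a <= q ->
  a ^+ n.+1 / q <= a ^+ n / k.
Proof.
move=> k_gt0 q_gt0 a_ge0 le_ka_q.
rewrite exprSr -mulrA ler_wpM2l ?exprn_ge0 //.
by rewrite ler_pdivrMr // ler_pdivlMl.
Qed.

Lemma interval_end_le_sqr b c d k p q :
    0 <= b -> 0 <= d -> 0 < k -> c + d / k <= b * k ->
    p <= 0 -> 0 < q -> k * `|p| <= q ->
  q ^+ 2 + b * p * q + c * p ^+ 2 + d * `|p| ^+ 3 / q <= q ^+ 2.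
Proof.
move=> b_ge0 d_ge0 k_gt0 le_cd_bk p_le0 q_gt0 le_kp_q.
have cubic_le : d * `|p| ^+ 3 / q <= d / k * p ^+ 2.
  rewrite -mulrA -[d / k * _]mulrA [k^-1 * _]mulrC -(real_normK (num_real p)).
  by rewrite ler_wpM2l // ler_exprS_div.
have quadratic_le : (c + d / k) * p ^+ 2 <= b * k * p ^+ 2.
  by rewrite ler_wpM2r ?sqr_ge0.
have product_le0 : b * p * (q + k * p) <= 0.
  rewrite mulr_le0_ge0 ?mulr_ge0_le0 //.
  by move: le_kp_q; rewrite ler0_norm // mulrN -subr_ge0 opprK.
by move: cubic_le quadratic_le product_le0; lra.
Qed.

End IntervalEnd.

Theorem theorem8p1 (pt qt : int) (hp : pt < 0) (hq : 0 < qt)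
    (hqp : 97 * `|pt| <= qt) :
  let A : int := qt ^+ 2 + 5 * pt * qt + 10 * pt ^+ 2 in
  let p : int := pt + qt in
  let q : int := qt in
  ~ exists t : int,
      [/\ A < t,
          t%:Q < A%:Q + 74 * (`|pt| ^+ 3)%:Q / qt%:Q
        & cuboid_inequalities p q t].
Proof.
move=> A p q [t [_ t_lt_end [_ _ t_gt_sqr _]]].
have end_le_sqr : A%:Q + 74 * (`|pt| ^+ 3)%:Q / qt%:Q <= (q ^+ 2)%:Q.
  have -> : A%:Q = qt%:Q ^+ 2 + 5 * pt%:Q * qt%:Q + 10 * pt%:Q ^+ 2.
    by rewrite /A; ring.
  have pt_le0 : pt%:Q <= 0 by rewrite lerz0 ltW.
  have qt_gt0 : 0 < qt%:Q by rewrite ltr0z.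
  have le_pt_qt : 97 * `|pt%:Q| <= qt%:Q.
    by rewrite -intr_norm -(rmorph_nat intr) -intrM ler_int.
  rewrite !rmorphXn /= intr_norm.
  by apply: (@interval_end_le_sqr _ 5 10 74 97) pt_le0 qt_gt0 le_pt_qt; lra.
by have := lt_le_trans t_lt_end end_le_sqr; rewrite ltr_int ltNge ltW.
Qed.
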